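(* Let $n\geq 2$ and let $\boldsymbol{X}=(X_1,\ldots,X_n)^\top$ be an exchangeable random vector with $\boldsymbol{X}\sim EC_n(\boldsymbol{\mu},\boldsymbol{\Sigma},g^{(n)})$, where $g^{(n)}(x)=\exp(-x/2)$ (that is, $\boldsymbol{X}$ is multivariate normal with mean vector $\boldsymbol\mu$ and positive-definite covariance matrix $\boldsymbol\Sigma$). Then $$GMD_n=\frac{2}{\sqrt{\pi}}\,\sigma_1\,\frac{1}{\binom{n}{2}}\sum_{1\leq i<j\leq n}\sqrt{1-\rho_{i,j}},$$ where $\sigma_1^2=\mathrm{Var}(X_1)$, $\sigma_1>0$, and $\rho_{i,j}=\mathrm{Corr}(X_i,X_j)$.
   Context: The Gini mean difference is $GMD_n=\frac{1}{\binom{n}{2}}\sum_{1\leq i<j\leq n}\mathbb{E}(|X_i-X_j|)$. $\boldsymbol{X}\sim EC_n(\boldsymbol{\mu},\boldsymbol{\Sigma},g^{(n)})$ (elliptically contoured distribution) means that $\boldsymbol X$ has joint density $f(\boldsymbol{x})=k_n|\boldsymbol{\Sigma}|^{-1/2}g^{(n)}[(\boldsymbol{x}-\boldsymbol{\mu})^\top\boldsymbol{\Sigma}^{-1}(\boldsymbol{x}-\boldsymbol{\mu})]$, $\boldsymbol{x}\in\mathbb{R}^n$, where $\boldsymbol\mu\in\mathbb{R}^n$, $\boldsymbol\Sigma$ is a positive-definite real $n\times n$ matrix, $|\boldsymbol\Sigma|$ is its determinant, and $k_n$ is a normalizing constant. Exchangeable means that $(X_1,\ldots,X_n)^\top$ has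 the same distribution as $(X_{i_1},\ldots,X_{i_n})^\top$ for every permutation $(i_1,\ldots,i_n)$ of $(1,\ldots,n)$. *)

(* Defs.v *)
From HB Require Import structures.
From mathcomp Require Import all_boot all_order all_algebra all_fingroup.
From mathcomp Require Import all_classical all_reals all_analysis.

Set Implicit Arguments.
Unset Strict Implicit.
Unset Printing Implicit Defensive.

Import Order.TTheory GRing.Theory Num.Theory.
Import numFieldNormedType.Exports.

Local Open Scope classical_set_scope.
Local Open Scope ring_scope.

Section tuple_lebesgue_measure.
Context (R : realType).

Definition tcons n (p : R * n.-tuple R) : n.+1.-tuple R :=
  [the n.+1.-tuple R of p.1 :: p.2].

Lemma measurable_tcons n : measurable_fun [set: R * n.-tuple R] (@tcons n).
Proof. exact: measurable_cons. Qed.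

Section lebesgue_step.
Variables (n : nat) (m : {sigma_finite_measure set (n.-tuple R) -> \bar R}).

Definition lebesgue_step : set (n.+1.-tuple R) -> \bar R :=
  pushforward (lebesgue_measure \x m)%E (@tcons n).

Let lebesgue_step0 : lebesgue_step set0 = 0%E.
Proof. by rewrite /lebesgue_step /pushforward preimage_set0 measure0. Qed.

Let lebesgue_step_ge0 A : (0 <= lebesgue_step A)%E.
Proof. by rewrite /lebesgue_step /pushforward. Qed.

Let lebesgue_step_sigma_additive : semi_sigma_additive lebesgue_step.
Proof.
have mt B : measurable B -> measurable (@tcons n @^-1` B).
  by move=> mB; rewrite -[X in measurable X]setTI; exact: measurable_tcons.
move=> F mF tF mUF; rewrite /lebesgue_step /pushforward preimage_bigcup.
apply: measure_semi_sigma_additive.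
- by move=> i; exact: mt.
- apply/trivIsetP => /= i j _ _ ij; rewrite -preimage_setI.
  by move/trivIsetP : tF => /(_ _ _ _ _ ij) ->//; rewrite preimage_set0.
- by rewrite -preimage_bigcup; exact: mt.
Qed.

HB.instance Definition _ := isMeasure.Build _ _ _ lebesgue_step
  lebesgue_step0 lebesgue_step_ge0 lebesgue_step_sigma_additive.

Let lebesgue_step_sigma_finite : sigma_finite setT lebesgue_step.
Proof.
have /sigma_finiteP[F [TF ndF Foo]] := sigma_finiteT (@lebesgue_measure R).
have /sigma_finiteP[G [TG ndG Goo]] := sigma_finiteT m.
pose tuncons (t : n.+1.-tuple R) : R * n.-tuple R :=
  (thead t, [tuple of behead t]).
have mu : measurable_fun [set: n.+1.-tuple R] tuncons.
  apply: measurable_fun_pair; first exact: measurable_tnth.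
  exact: measurable_behead.
exists (fun k => tuncons @^-1` (F k `*` G k)).
  apply/seteqP; split => // t _.
  have [i _ Fi] : (\bigcup_i F i) (tuncons t).1 by rewrite -TF.
  have [j _ Gj] : (\bigcup_j G j) (tuncons t).2 by rewrite -TG.
  exists (maxn i j) => //; split.
  - by move: Fi; exact/subsetPset/ndF/leq_maxl.
  - by move: Gj; exact/subsetPset/ndG/leq_maxr.
move=> k; have [mFk Fkoo] := Foo k; have [mGk Gkoo] := Goo k; split.
  by rewrite -[X in measurable X]setTI; apply: mu => //; exact: measurableX.
rewrite /lebesgue_step /pushforward (_ : _ @^-1` _ = F k `*` G k).
  by rewrite product_measure1E// lte_mul_pinfty// ge0_fin_numE.
rewrite -comp_preimage (_ : tuncons \o _ = id)//.
apply/funext => -[x t]; rewrite /tuncons /tcons /= theadE.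
by congr pair; exact/val_inj.
Qed.

HB.instance Definition _ := Measure_isSigmaFinite.Build _ _ _ lebesgue_step
  lebesgue_step_sigma_finite.

End lebesgue_step.

Fixpoint lebesgue_tuple n : {sigma_finite_measure set (n.-tuple R) -> \bar R} :=
  match n with
  | 0 => \d_([tuple] : 0.-tuple R)
  | k.+1 => lebesgue_step (lebesgue_tuple k)
  end.

End tuple_lebesgue_measure.

Lemma lebesgue_tuple_box (R : realType) n (A : 'I_n -> set R) :
    (forall i, measurable (A i)) ->
  lebesgue_tuple R n [set t | forall i, A i (tnth t i)] =
  (\prod_(i < n) lebesgue_measure (A i))%E.
Proof.
elim: n A => [|n IH] A mA.
  by rewrite big_ord0 /= diracE mem_set// => -[].
have mB : measurable
    [set t : n.-tuple R | forall i, A (lift ord0 i) (tnth t i)].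
  rewrite (_ : [set t | _] = \bigcap_(i in [set: 'I_n])
      (fun t : n.-tuple R => tnth t i) @^-1` A (lift ord0 i)).
    apply: fin_bigcap_measurable => // i _.
    by rewrite -[X in measurable X]setTI; exact: measurable_tnth.
  by apply/seteqP; split => t /= h i; [move=> _|]; exact: h.
rewrite big_ord_recl -(IH (fun i => A (lift ord0 i)))//.
rewrite /= /lebesgue_step /pushforward.
rewrite -(product_measure1E lebesgue_measure (lebesgue_tuple R n))//.
  congr (_ _); apply/seteqP; split => -[x t] /=.
    move=> h; split => [|i]; first by have := h ord0; rewrite tnth0.
    by have := h (lift ord0 i); rewrite tnthS.
  move=> [h0 h] i; case: (unliftP ord0 i) => [j|] ->; first by rewrite tnthS.
  by rewrite tnth0.
exact: mA.
Qed.

Section random_vector.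
Context d (T : measurableType d) (R : realType) (P : probability T R) (n : nat).
Implicit Type X : {RV P >-> n.-tuple R}.

Definition component X (i : 'I_n) : T -> R := fun w => tnth (X w) i.

Definition has_joint_density X (f : n.-tuple R -> R) : Prop :=
  [/\ measurable_fun [set: n.-tuple R] f,
      forall x, 0 <= f x &
      forall A, measurable A ->
        distribution P X A = (\int[lebesgue_tuple R n]_(x in A) (f x)%:E)%E].

Definition positive_definite (S : 'M[R]_n) : Prop :=
  S^T = S /\ forall v : 'cV[R]_n, v != 0 -> 0 < (v^T *m S *m v) 0 0.

Definition ec_density (k : R) (mu : 'cV[R]_n) (S : 'M[R]_n) (g : R -> R)
    (x : n.-tuple R) : R :=
  let y := \col_i tnth x i - mu in
  k * (Num.sqrt (\det S))^-1 * g ((y^T *m invmx S *m y) 0 0).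

(* The constant k is normalizing because the density integrates to P setT = 1. *)
Definition elliptically_contoured X (mu : 'cV[R]_n) (S : 'M[R]_n)
    (g : R -> R) : Prop :=
  positive_definite S /\ exists k, has_joint_density X (ec_density k mu S g).

(* Laws are compared on measurable sets only: the values of a measure on other
   sets carry no meaning. *)
Definition exchangeable X : Prop :=
  forall (s : 'S_n) (A : set (n.-tuple R)), measurable A ->
    P (X @^-1` A) = P ((fun w => [tuple component X (s i) w | i < n]) @^-1` A).

Definition GMD X : \bar R :=
  ((('C(n, 2))%:R^-1)%:E *
   \sum_(i < n) \sum_(j < n | (i < j)%N)
     'E_P[fun w => `|component X i w - component X j w|%R])%E.

Definition std_deviation (Y : T -> R) : R := Num.sqrt (fine 'V_P[Y]).

Definition correlation (Y Z : T -> R) : R :=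
  fine (covariance P Y Z) / (std_deviation Y * std_deviation Z).

End random_vector.
Arguments std_deviation {d T R} P Y.
Arguments correlation {d T R} P Y Z.

(* Main.v *)
Require Import Defs.
From HB Require Import structures.
From mathcomp Require Import all_boot all_order all_algebra all_fingroup.
From mathcomp Require Import all_classical all_reals all_analysis.
From mathcomp Require Import measurable_realfun ring.

Set Implicit Arguments.
Unset Strict Implicit.
Unset Printing Implicit Defensive.

Import Order.TTheory GRing.Theory Num.Theory.
Import numFieldNormedType.Exports.

Local Open Scope classical_set_scope.
Local Open Scope ring_scope.

(** If [W] is a centred normal variable with variance [t ^ 2], then the mean
of [|W|] is [t * sqrt (2 / pi)].  Apply this to [W = X_i - X_j].
Exchangeability gives [X_i] and [X_j] the same mean, so that [W] is centred,
and the same variance [sigma1 ^ 2], so that the variance of [W] is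
[2 * sigma1 ^ 2 * (1 - rho i j)].  The mean of [|W|] is therefore
[2 / sqrt pi * sigma1 * sqrt (1 - rho i j)], and summing over the pairs gives
the formula.  This computation is [abs_difference_gaussian].

What remains is that each [X_i] and each [X_i - X_j] is normal, starting from
the joint density.  No [n]-dimensional change of variables is used.  The
first coordinate of a Gaussian kernel exp (- Q / 2) can be integrated out by
completing the square, which leaves the kernel of the Schur complement of [Q]
([integral_gauss_kernel_head]).  Repeating this down to two coordinates
shows that some pair [(X_i0, X_j0)] has a bivariate Gaussian density
([gauss_kernel_pair_marginal]), and exchangeability carries that density over
to all pairs of distinct indices ([exchangeable_gaussian_pair]).  For a pair
[(U, V)], integrating out [u] gives the law of [V], and the one-dimensional
shear [u = w + v] followed by integrating out [v] gives the law of [U - V];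
in both cases one more completion of the square produces a normal density.

Laws are handled through the integrals of nonnegative measurable functions,
so that these marginalisations reduce to Tonelli's theorem and to affine
substitutions on the real line. *)

(** * Integration against a density, affine substitutions *)

Section density.
Context d (T : measurableType d) (R : realType).
Import HBNNSimple.
Local Open Scope ereal_scope.

(** Both sides commute with the monotone limit of simple functions
approximating [phi], and they agree on indicators by hypothesis. *)
Lemma ge0_integral_density (lam nu : {measure set T -> \bar R}) (f : T -> R) :
    measurable_fun [set: T] f -> (forall x, (0 <= f x)%R) ->
    (forall A, measurable A -> nu A = \int[lam]_(x in A) (f x)%:E) ->
  forall phi : T -> \bar R, measurable_fun [set: T] phi ->
    (forall x, 0 <= phi x) ->
  \int[nu]_x phi x = \int[lam]_x (phi x * (f x)%:E).
Proof.
move=> mf f0 nuE phi mphi phi0.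
pose h := nnsfun_approx measurableT mphi.
have hphi x : phi x = limn (EFin \o h ^~ x).
  by apply/esym/cvg_lim => //; exact: cvg_nnsfun_approx.
have mfE : measurable_fun [set: T] (EFin \o f) by exact/measurable_EFinP.
transitivity (limn (fun n => \int[nu]_x (h n x)%:E)).
  rewrite -monotone_convergence//; first by apply: eq_integral => x _.
  - by move=> n; exact/measurable_EFinP.
  - by move=> n x _; rewrite lee_fin.
  - by move=> x _ a b ab; rewrite lee_fin; exact/lefP/nd_nnsfun_approx.
transitivity (limn (fun n => \int[lam]_x ((h n x)%:E * (f x)%:E))); last first.
  rewrite -monotone_convergence//.
  - apply: eq_integral => x _; apply/cvg_lim => //.
    by apply: cvgeZr => //; exact: cvg_nnsfun_approx.
  - by move=> n; apply: emeasurable_funM => //; exact/measurable_EFinP.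
  - by move=> n x _; rewrite mule_ge0 ?lee_fin.
  - move=> x _ a b ab; rewrite lee_wpmul2r ?lee_fin//.
    exact/lefP/nd_nnsfun_approx.
suff hE n : \int[nu]_x (h n x)%:E = \int[lam]_x ((h n x)%:E * (f x)%:E).
  by under eq_fun do rewrite hE.
have ind0 y x : 0 <= (y * \1_(h n @^-1` [set y]) x)%:E.
  by rewrite nnfun_muleindic_ge0.
have mind y : measurable_fun [set: T]
    (fun x => (y * \1_(h n @^-1` [set y]) x)%:E).
  by apply/measurable_EFinP; exact: measurable_funM.
under eq_integral do rewrite fimfunE -fsumEFin//.
under [RHS]eq_integral do rewrite fimfunE -fsumEFin// ge0_mule_fsuml//.
rewrite !ge0_integral_fsum//; last 2 first.
- by move=> y; exact: emeasurable_funM.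
- by move=> y x _; rewrite mule_ge0// lee_fin.
apply: eq_fsbigr => y _.
have mS : measurable (h n @^-1` [set y]) by [].
rewrite integralZl_indic_nnsfun// integral_indic//= setIT nuE//.
have [y0|y0] := ltP y 0%R.
  rewrite preimage_nnfun0// integral_set0 mule0.
  by rewrite integral0_eq// => x _; rewrite indicE in_set0 mulr0 mul0e.
under [RHS]eq_integral do rewrite EFinM -muleA.
rewrite ge0_integralZl//; last 2 first.
- apply: emeasurable_funM => //; exact/measurable_EFinP.
- by move=> x _; rewrite mule_ge0 ?lee_fin.
congr (_ * _); rewrite integral_mkcond; apply: eq_integral => x _.
by rewrite patchE indicE; case: ifPn; rewrite ?mul1e ?mul0e.
Qed.
End density.

Section lebesgue_substitution.
Context (R : realType).
Local Open Scope ereal_scope.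
Notation leb := (@lebesgue_measure R).

(** The image of the Lebesgue measure by [x |-> b + a * x], scaled by [a],
agrees with the Lebesgue measure on half-open intervals, which characterises
the latter. *)
Lemma ge0_integral_affine (a b : R) (h : R -> \bar R) : (0 < a)%R ->
    measurable_fun [set: R] h -> (forall x, 0 <= h x) ->
  \int[leb]_x h x = \int[leb]_x (h (b + a * x)%R * a%:E).
Proof.
move=> a0 mh h0.
pose g := (fun x : measurableTypeR R => (b + a * x)%R : measurableTypeR R).
have mg : measurable_fun [set: measurableTypeR R] g.
  apply: measurable_funD => //; exact: measurable_funM.
have ge0a : (0 <= a)%R by exact: ltW.
pose aN : {nonneg R} := NngNum ge0a.
pose nu := mscale aN
  (measure_function_pushforward__canonical__measure_function_Measure leb mg).
transitivity (\int[nu]_x h x).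
  apply: eq_measure_integral => A mA _; apply: lebesgue_measure_unique => //.
  move=> _ [[u v]] _ <-.
  rewrite -[RHS]/(a%:E * leb (g @^-1` `]u, v]%classic)).
  rewrite (_ : g @^-1` _ = `](u - b) / a, (v - b) / a]%classic)%R; last first.
    apply/seteqP; split => x /=; rewrite !in_itv/= /g;
      by rewrite ltr_pdivrMr// ler_pdivlMr// ltrBlDl lerBrDl (mulrC x).
  rewrite !lebesgue_measure_itv/= !lte_fin ltr_pM2r ?invr_gt0// ltrD2r.
  case: ifPn => _; last by rewrite mule0.
  rewrite -!EFinD -EFinM; congr EFin; field; exact: lt0r_neq0.
rewrite /nu ge0_integral_mscale//= ge0_integral_pushforward//.
under [RHS]eq_integral do rewrite muleC.
rewrite ge0_integralZl//.
exact: (measurableT_comp mh mg).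
Qed.

Lemma ge0_integral_reflect (h : R -> \bar R) :
    measurable_fun [set: R] h -> (forall x, 0 <= h x) ->
  \int[leb]_x h x = \int[leb]_x h (- x)%R.
Proof.
move=> mh h0.
transitivity (\int[pushforward leb (-%R : _ -> measurableTypeR R)]_x h x).
  by apply: eq_measure_integral => A mA _; exact/esym/lebesgue_measureN.
by rewrite ge0_integral_pushforward.
Qed.

End lebesgue_substitution.

(** * Absolute moments of the Gaussian function *)

Section gauss_moments.
Context (R : realType).
Notation leb := (@lebesgue_measure R).

Lemma integral_itvcy_mul_gauss (y : R) : 0 <= y ->
  (\int[leb]_(x in `[y, +oo[) (x * gauss_fun x)%:E = (gauss_fun y / 2)%:E)%E.
Proof.
move=> y0.
have dF x : is_derive x (1 : R) (fun z : R => - (gauss_fun z / 2))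
    (x * gauss_fun x).
  rewrite /gauss_fun; apply: is_derive_eq.
  rewrite /GRing.scale/=.
  by field.
rewrite (@ge0_continuous_FTC2y _ _ (fun z : R => - (gauss_fun z / 2)) y 0).
- by rewrite -EFinB; congr EFin; ring.
- by move=> x yx; rewrite mulr_ge0 ?gauss_fun_ge0// (le_trans y0).
- apply: continuous_subspaceT => x.
  by apply: cvgM; [exact: cvg_id|exact: continuous_gauss_fun].
- rewrite -oppr0 -(mul0r 2^-1); apply: cvgN; apply: cvgMl.
  exact: cvg_gauss_fun.
- by move=> x _; exact: ex_derive.
- apply: cvg_at_right_filter; apply: cvgN; apply: cvgMl.
  exact: continuous_gauss_fun.
- by move=> x _; rewrite derive1E; exact: derive_val.
Qed.

Lemma integralT_norm_gauss :
  (\int[leb]_x (`|x| * gauss_fun x)%:E = 1)%E.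
Proof.
rewrite ge0_symfun_integralT; first last.
- by move=> x /=; rewrite normrN /gauss_fun sqrrN.
- move=> x; apply: cvgM; last exact: continuous_gauss_fun.
  exact: norm_continuous.
- by move=> x; rewrite mulr_ge0 ?gauss_fun_ge0.
rewrite -set_itvcy.
under eq_integral.
  move=> x; rewrite inE/= in_itv/= andbT => x0.
  rewrite (ger0_norm x0); over.
rewrite integral_itvcy_mul_gauss// /gauss_fun expr0n oppr0 expR0.
by rewrite -EFinM; congr EFin; field.
Qed.

(** Write one factor [x] as the length of the segment from 0 to [x] and
exchange the order of integration: the inner integral over [x >= y] is
[gauss_fun y / 2], so that the second moment reduces to the integral of the
Gaussian function. *)
Lemma integralT_sqr_gauss :
  (\int[leb]_x (x ^+ 2 * gauss_fun x)%:E = (Num.sqrt pi / 2)%:E)%E.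
Proof.
rewrite ge0_symfun_integralT; first last.
- by move=> x /=; rewrite sqrrN /gauss_fun sqrrN.
- move=> x; apply: cvgM; last exact: continuous_gauss_fun.
  exact: exprn_continuous.
- by move=> x; rewrite mulr_ge0 ?gauss_fun_ge0 ?sqr_ge0.
rewrite -set_itvcy.
(* [F (x, y)] is [x * gauss_fun x] restricted to [0 <= y <= x]. *)
pose F (p : R * R) := (p.1 * gauss_fun p.1 *
  (\1_`[0%R, +oo[ p.2 * \1_`[0%R, +oo[ (p.1 - p.2)))%:E.
have F0 p : (0 <= F p)%E.
  rewrite lee_fin !indicE !mem_setE !in_itv/= !andbT.
  case: (leP 0 p.2) => p2; case: (leP 0 (p.1 - p.2)) => p12;
    rewrite ?(mulr0, mul0r)// !mulr1 mulr_ge0 ?gauss_fun_ge0//.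
  by move: p12; rewrite subr_ge0; exact: le_trans p2.
have mF : measurable_fun setT F.
  apply/measurable_EFinP; apply: measurable_funM.
    apply: measurable_funM => //.
    by apply: measurableT_comp => //; exact: measurable_gauss_fun.
  apply: measurable_funM; first by apply: measurableT_comp.
  apply: (measurableT_comp (measurable_indic _)) => //.
  by apply: measurable_funB.
transitivity (2 * (\int[leb]_x \int[leb]_y F (x, y)))%E.
  congr (_ * _)%E; rewrite integral_mkcond; apply: eq_integral => x _.
  rewrite patchE /F /= mem_setE in_itv/= andbT; case: ifPn => x0; last first.
    rewrite integral0_eq// => z _; congr EFin.
    rewrite !indicE !mem_setE !in_itv/= !andbT.
    case: (leP 0 z) => z0; case: (leP 0 (x - z)) => xz;
      rewrite ?(mulr0, mul0r)//.
    by move: xz; rewrite subr_ge0 => /(le_trans z0); rewrite (negbTE x0).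
  under eq_integral do rewrite EFinM.
  have x0E z : \1_`[0%R, +oo[ z * \1_`[0%R, +oo[ (x - z) = \1_`[0, x] z :> R.
    rewrite !indicE !mem_setE !in_itv/= !andbT subr_ge0.
    by case: (0 <= z); rewrite ?mul1r ?mul0r.
  under eq_integral do rewrite x0E.
  rewrite ge0_integralZl//; last 2 first.
  - by apply/measurable_EFinP.
  - by rewrite lee_fin mulr_ge0 ?gauss_fun_ge0.
  rewrite integral_indic//= setIT lebesgue_measure_itv/= lte_fin.
  case: ltP => xp.
    by rewrite -EFinD -EFinM; congr EFin; ring.
  have -> : x = 0 by apply/le_anti; rewrite x0 xp.
  by rewrite expr0n !mul0r mule0.
rewrite fubini_tonelli//.
transitivity (2 * \int[leb]_(y in `[0%R, +oo[) (gauss_fun y * 2^-1)%:E)%E.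
  congr (_ * _)%E; rewrite [RHS]integral_mkcond; apply: eq_integral => y _.
  rewrite patchE /F /= mem_setE in_itv/= andbT; case: ifPn => y0; last first.
    rewrite integral0_eq// => z _; congr EFin.
    by rewrite indicE mem_setE in_itv/= (negbTE y0) mul0r mulr0.
  rewrite -integral_itvcy_mul_gauss// [RHS]integral_mkcond.
  apply: eq_integral => x _; rewrite patchE !indicE !mem_setE !in_itv/= !andbT.
  by rewrite y0 mul1r subr_ge0; case: ifPn; rewrite ?mulr1 ?mulr0.
under eq_integral do rewrite EFinM.
rewrite ge0_integralZr//; last 2 first.
- apply/measurable_EFinP/measurable_funTS; exact: measurable_gauss_fun.
- by move=> x _; rewrite lee_fin gauss_fun_ge0.
by rewrite integral0y_gauss -!EFinM; congr EFin; field.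
Qed.
End gauss_moments.

(** * Normal laws on the real line *)

Section gaussian_law.
Context d (T : measurableType d) (R : realType) (P : probability T R).
Notation leb := (@lebesgue_measure R).
Implicit Types (V : T -> R) (m r : R).
Local Open Scope ereal_scope.

(** [V] has the law of [m + r * Y], where [Y] has density [exp (- y ^ 2)] up
to normalisation: this is the normal law of mean [m] and variance
[r ^ 2 / 2].  With this scaling, moments of [V] are moments of [gauss_fun]. *)
Definition gaussian_law V m r := forall phi : R -> \bar R,
  measurable_fun [set: R] phi -> (forall x, 0 <= phi x) ->
  \int[P]_w phi (V w) =
  \int[leb]_y (phi (m + r * y)%R * (gauss_fun y / Num.sqrt pi)%:E).

(** The constant [K] is determined by the total mass: taking [phi = 1] gives
[K / p = 1 / sqrt pi]. *)
Lemma gaussian_law_of_density V m p K : (0 < p)%R -> (0 <= K)%R ->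
    (forall phi : R -> \bar R,
      measurable_fun [set: R] phi -> (forall x, 0 <= phi x) ->
      \int[P]_w phi (V w) =
      \int[leb]_x (phi x * (K * gauss_fun (p * (x - m)))%:E)) ->
  gaussian_law V m p^-1.
Proof.
move=> p0 K0 Vp.
have mg : measurable_fun [set: R] (fun x => K * gauss_fun (p * (x - m)))%R.
  apply: measurable_funM => //; apply: measurableT_comp => //.
    exact: measurable_gauss_fun.
  by apply: measurable_funM => //; exact: measurable_funB.
have Vp' phi : measurable_fun [set: R] phi -> (forall x, 0 <= phi x) ->
    \int[P]_w phi (V w) =
    \int[leb]_y (phi (m + p^-1 * y)%R * (K / p * gauss_fun y)%:E).
  move=> mphi phi0; rewrite (Vp _ mphi phi0) (@ge0_integral_affine _ p^-1 m).
  - apply: eq_integral => y _; rewrite -muleA -EFinM; congr (_ * _%:E).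
    have -> : (p * (m + p^-1 * y - m) = y)%R by field; exact: lt0r_neq0.
    by ring.
  - by rewrite invr_gt0.
  - by apply: emeasurable_funM => //; exact/measurable_EFinP.
  - by move=> x; rewrite mule_ge0 ?lee_fin ?mulr_ge0 ?gauss_fun_ge0.
have KpE : (K / p = (Num.sqrt pi)^-1)%R.
  have := Vp' (cst 1) (measurable_cst _) (fun=> lee01).
  rewrite integral_cst//= probability_setT mul1e.
  under eq_integral do rewrite mul1e EFinM.
  rewrite ge0_integralZl//; last 3 first.
  - by apply/measurable_EFinP; exact: measurable_gauss_fun.
  - by move=> x _; rewrite lee_fin gauss_fun_ge0.
  - by rewrite lee_fin divr_ge0// ltW.
  rewrite integralT_gauss -EFinM => -[KE].
  have s0 : Num.sqrt pi != 0%R :> R by rewrite gt_eqF// sqrtr_gt0 pi_gt0.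
  by apply: (mulIf s0); rewrite -KE mulVf.
move=> phi mphi phi0; rewrite (Vp' _ mphi phi0) KpE; apply: eq_integral => y _.
by rewrite [((Num.sqrt pi)^-1 * _)%R]mulrC.
Qed.

Section moments.
Variables (V : T -> R) (m r : R).
Hypothesis mV : measurable_fun [set: T] V.
Hypothesis r_ge0 : (0 <= r)%R.
Hypothesis VN : gaussian_law V m r.

Let sqrt_pi_gt0 : (0 < Num.sqrt pi :> R)%R.
Proof. by rewrite sqrtr_gt0 pi_gt0. Qed.

Let mVB : measurable_fun [set: T] (fun w => V w - m)%R.
Proof. exact: measurable_funB. Qed.

Lemma gaussian_abs_moment : \int[P]_w `|V w - m|%:E = (r / Num.sqrt pi)%:E.
Proof.
rewrite (VN (phi := fun x => `|x - m|%:E))//; last first.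
  apply/measurable_EFinP; apply: measurableT_comp => //; exact: measurable_funB.
transitivity (\int[leb]_y ((r / Num.sqrt pi)%:E * (`|y| * gauss_fun y)%:E)).
  apply: eq_integral => y _; rewrite -!EFinM; congr EFin.
  by rewrite addrC addKr normrM (ger0_norm r_ge0); ring.
rewrite ge0_integralZl//; last 3 first.
- apply/measurable_EFinP/measurable_funM; first by [].
  exact: measurable_gauss_fun.
- by move=> x _; rewrite lee_fin mulr_ge0// gauss_fun_ge0.
- by rewrite lee_fin divr_ge0// ltW.
by rewrite integralT_norm_gauss mule1.
Qed.

Lemma gaussian_sqr_moment : \int[P]_w ((V w - m) ^+ 2)%:E = (r ^+ 2 / 2)%:E.
Proof.
rewrite (VN (phi := fun x => ((x - m) ^+ 2)%:E))//; last 2 first.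
  by apply/measurable_EFinP; apply: measurable_funX; exact: measurable_funB.
- by move=> x; rewrite lee_fin sqr_ge0.
transitivity (\int[leb]_y ((r ^+ 2 / Num.sqrt pi)%:E *
    (y ^+ 2 * gauss_fun y)%:E)).
  apply: eq_integral => y _; rewrite -!EFinM; congr EFin.
  by rewrite addrC addKr exprMn; ring.
rewrite ge0_integralZl//; last 3 first.
- apply/measurable_EFinP/measurable_funM; first exact: measurable_funX.
  exact: measurable_gauss_fun.
- by move=> x _; rewrite lee_fin mulr_ge0 ?sqr_ge0 ?gauss_fun_ge0.
- by rewrite lee_fin divr_ge0 ?sqr_ge0// ltW.
rewrite integralT_sqr_gauss -EFinM; congr EFin; field.
exact: lt0r_neq0.
Qed.

Lemma gaussian_Lfun2 : V \in Lfun P 2%:E.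
Proof.
have VB2 : (V \- cst m)%R \in Lfun P 2%:E.
  rewrite inE; apply/andP; split; rewrite inE//=.
  rewrite /finite_norm unlock /= poweR_lty//.
  rewrite (_ : integral _ _ _ = (r ^+ 2 / 2)%:E) ?ltry//.
  rewrite -gaussian_sqr_moment; apply: eq_integral => w _.
  by rewrite powR_mulrn// real_normK ?num_real.
rewrite (_ : V = (V \- cst m) \+ cst m)%R; last first.
  by apply/funext => w /=; rewrite subrK.
rewrite rpredD ?lee1n//= => _; exact: Lfun_cst.
Qed.

(** The positive and negative parts of [V - m] have the same integral because
[gauss_fun] is even. *)
Lemma gaussian_expectation : 'E_P[V] = m%:E.
Proof.
have V1 := Lfun_subset12 (fin_num_measure P _ measurableT) gaussian_Lfun2.
have c1 : cst m \in Lfun P 1 by exact: Lfun_cst.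
suff EVm : 'E_P[(V \- cst m)%R] = 0.
  move: EVm; rewrite expectationB// expectation_cst => /eqP.
  rewrite sube_eq// ?expectation_fin_num// ?fin_num_adde_defr//.
  by rewrite add0e => /eqP.
have iVm : P.-integrable [set: T] (EFin \o (V \- cst m)%R).
  by apply/Lfun1_integrable; rewrite rpredB.
pose pos (x : R) : \bar R := maxe (x - m)%:E 0.
pose neg (x : R) : \bar R := maxe (- (x - m)%:E) 0.
have mB : measurable_fun [set: R] (fun x : R => (x - m)%:E).
  by apply/measurable_EFinP; exact: measurable_funB.
have mpos : measurable_fun [set: R] pos by exact: measurable_maxe.
have mneg : measurable_fun [set: R] neg.
  by apply: measurable_maxe => //; exact: measurableT_comp.
have pos0 x : 0 <= pos x by rewrite le_max lexx orbT.
have neg0 x : 0 <= neg x by rewrite le_max lexx orbT.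
have posneg : \int[P]_w pos (V w) = \int[P]_w neg (V w).
  rewrite (VN mpos pos0) (VN mneg neg0) [LHS]ge0_integral_reflect; last 2 first.
  - apply: emeasurable_funM.
      apply: measurableT_comp => //.
      by apply: measurable_funD => //; exact: measurable_funM.
    apply/measurable_EFinP; apply: measurable_funM => //.
    exact: measurable_gauss_fun.
  - by move=> x; rewrite mule_ge0// lee_fin divr_ge0// ?gauss_fun_ge0// ltW.
  apply: eq_integral => y _; rewrite /pos /neg /gauss_fun sqrrN.
  congr (maxe _ _ * _); rewrite -EFinN; congr EFin; ring.
have posE : \int[P]_w pos (V w) = \int[P]_w (EFin \o (V \- cst m)%R)^\+ w.
  by apply: eq_integral => w _; rewrite funeposE.
have negE : \int[P]_w neg (V w) = \int[P]_w (EFin \o (V \- cst m)%R)^\- w.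
  by apply: eq_integral => w _; rewrite funenegE.
rewrite unlock integralE -[X in X - _]posE -[X in _ - X]negE -posneg posE.
rewrite subee//.
exact: (integrable_pos_fin_num measurableT iVm).
Qed.

Lemma gaussian_variance : 'V_P[V] = (r ^+ 2 / 2)%:E.
Proof.
rewrite /variance unlock gaussian_expectation -gaussian_sqr_moment.
by rewrite unlock; apply: eq_integral => w _; rewrite -expr2.
Qed.

End moments.
End gaussian_law.

(** * Quadratic forms and Schur complements *)

Section quadratic_forms.
Context (R : realType).

Definition qform n (A : 'M[R]_n) (v : 'cV[R]_n) : R := (v^T *m A *m v) 0 0.

Lemma qform_sum n (A : 'M[R]_n) v :
  qform A v = \sum_j (\sum_i v i 0 * A i j) * v j 0.
Proof.
rewrite /qform mxE; apply: eq_bigr => j _; rewrite !mxE.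
by congr (_ * _); apply: eq_bigr => i _; rewrite !mxE.
Qed.

Definition schur n (A : 'M[R]_(1 + n)) : 'M[R]_n :=
  drsubmx A - (A 0 0)^-1 *: (dlsubmx A *m ursubmx A).

Section schur_complement.
Variables (n : nat) (A : 'M[R]_(1 + n)).
Hypothesis symA : A^T = A.

Let dlE : dlsubmx A = (ursubmx A)^T.
Proof. by rewrite trmx_ursub symA. Qed.

Lemma qform_col_mx (x : R) (y : 'cV[R]_n) :
  qform A (col_mx x%:M y) =
  A 0 0 * x ^+ 2 + 2 * (x * (ursubmx A *m y) 0 0) + qform (drsubmx A) y.
Proof.
rewrite /qform -{1}[A]submxK tr_col_mx mul_row_block mul_row_col tr_scalar_mx.
rewrite !mulmxDl !mul_scalar_mx !mul_mx_scalar.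
rewrite -scalemxAl dlE.
have -> : y^T *m (ursubmx A)^T = ((ursubmx A *m y)^T) by rewrite trmx_mul.
rewrite !mxE.
have -> : lshift n (0 : 'I_1) = 0 by exact: val_inj.
by ring.
Qed.

(** When [A 0 0 > 0], the value at [y] of the Schur complement is the minimum
over [x] of the form in [qform_col_mx]. *)
Lemma qform_schur (y : 'cV[R]_n) :
  qform (schur A) y =
  qform (drsubmx A) y - ((ursubmx A *m y) 0 0) ^+ 2 / A 0 0.
Proof.
rewrite /qform /schur mulmxBr mulmxBl -scalemxAr -scalemxAl.
rewrite mulmxA dlE -trmx_mul -mulmxA [LHS]mxE; congr (_ + _).
rewrite [LHS]mxE [X in - X]mxE; congr (- _).
rewrite -mulmxA [X in _ * X = _]mxE big_ord1.
by rewrite [X in _ * (X * _)]mxE -expr2 mulrC.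
Qed.

End schur_complement.

Lemma positive_definite_diag n (A : 'M[R]_n) i :
  positive_definite A -> 0 < A i i.
Proof.
move=> [_ /(_ (delta_mx i 0))].
rewrite trmx_delta -rowE -colE !mxE; apply.
by apply/eqP => /matrixP/(_ i 0); rewrite !mxE !eqxx => /eqP; rewrite oner_eq0.
Qed.

(** The Schur complement takes at [y] the value of [A] at the vector [(x, y)]
whose first coordinate [x = - s / A 0 0] is the minimiser. *)
Lemma schur_positive_definite n (A : 'M[R]_(1 + n)) :
  positive_definite A -> positive_definite (schur A).
Proof.
move=> pA; have a0 : 0 < A 0 0 := positive_definite_diag 0 pA.
have [symA posA] := pA; split=> [|y y0].
  rewrite /schur linearB/= linearZ/= trmx_mul trmx_drsub symA.
  by rewrite trmx_ursub trmx_dlsub symA.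
rewrite -/(qform _ _) qform_schur//.
set s := (ursubmx A *m y) 0 0.
have := posA (col_mx (- (s / A 0 0))%:M y).
rewrite -/(qform _ _) qform_col_mx// -/s => /(_ _)/lt_le_trans; apply.
  by rewrite col_mx_eq0 negb_and y0 orbT.
rewrite le_eqVlt; apply/orP; left; apply/eqP.
by field; exact: lt0r_neq0.
Qed.

Lemma positive_definite_inv n (A : 'M[R]_n) :
  positive_definite A -> positive_definite (invmx A).
Proof.
move=> [symA posA].
have uA : A \in unitmx.
  rewrite -row_free_unit; apply: inj_row_free => v vA0.
  apply/eqP; apply: contraT => v0.
  have := posA v^T; rewrite trmxK vA0 mul0mx mxE ltxx; apply.
  by rewrite -trmx0 (inj_eq trmx_inj).
split=> [|v v0]; first by rewrite trmx_inv symA.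
have := posA (invmx A *m v).
rewrite trmx_mul trmx_inv symA mulmxKV// mulmxA; apply.
apply: contra_neq v0 => Av0; by rewrite -(mulKVmx uA v) Av0 mulmx0.
Qed.

End quadratic_forms.

(** * Marginals of Gaussian kernels *)

Section marginals.
Context (R : realType).
Notation leb := (@lebesgue_measure R).
Local Open Scope ereal_scope.

Lemma integral_lebesgue_tupleS n (f : n.+1.-tuple R -> \bar R) :
    measurable_fun [set: n.+1.-tuple R] f -> (forall t, 0 <= f t) ->
  \int[lebesgue_tuple R n.+1]_t f t =
  \int[lebesgue_tuple R n]_t \int[leb]_x f (tcons (x, t)).
Proof.
move=> mf f0.
transitivity (\int[(leb \x lebesgue_tuple R n)%E]_p f (tcons p)).
  have mt := @measurable_tcons R n.
  transitivity (\int[measure_function_pushforward__canonical__measure_function_Measure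
      (leb \x lebesgue_tuple R n)%E mt]_t f t).
    exact: eq_measure_integral.
  rewrite ge0_integral_pushforward//.
rewrite (@fubini_tonelli2 _ _ _ _ _ leb (lebesgue_tuple R n)
  (fun p => f (tcons p)))//.
by apply: measurableT_comp => //; exact: measurable_tcons.
Qed.

Lemma measurable_integral_head n (f : n.+1.-tuple R -> \bar R) :
    measurable_fun [set: n.+1.-tuple R] f -> (forall t, 0 <= f t) ->
  measurable_fun [set: n.-tuple R] (fun t => \int[leb]_x f (tcons (x, t))).
Proof.
move=> mf f0.
apply: (measurable_fun_fubini_tonelli_G (m1 := leb)
  (fun p => f (tcons p))) => //.
by apply: (measurableT_comp mf); exact: measurable_tcons.
Qed.

(** Completing the square: the minimum of the quadratic polynomial in [x],
[q - s ^ 2 / a], factors out and leaves a translated Gaussian integral. *)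
Lemma integral_gauss_quadratic (a s q c : R) : (0 < a)%R ->
  \int[leb]_x (expR (- (a * (x - c) ^+ 2 + 2 * ((x - c) * s) + q) / 2))%:E =
  (Num.sqrt pi / Num.sqrt (a / 2) * expR (- (q - s ^+ 2 / a) / 2))%:E.
Proof.
move=> a0; set p := Num.sqrt (a / 2).
have a2 : (0 < a / 2)%R by rewrite divr_gt0.
have p0 : (0 < p)%R by rewrite sqrtr_gt0.
have pE : (p ^+ 2 = a / 2)%R by rewrite sqr_sqrtr// ltW.
rewrite (@ge0_integral_affine _ p^-1 (c - s / a)); first last.
- by move=> x; rewrite lee_fin expR_ge0.
- apply/measurable_EFinP; apply: measurableT_comp => //.
  apply: measurable_funM => //; apply: measurableT_comp => //.
  apply: measurable_funD => //; apply: measurable_funD => //.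
    apply: measurable_funM => //; apply: measurable_funX.
    exact: measurable_funB.
  apply: measurable_funM => //.
  by apply: measurable_funM => //; exact: measurable_funB.
- by rewrite invr_gt0.
transitivity (\int[leb]_y ((expR (- (q - s ^+ 2 / a) / 2) / p)%:E *
    (gauss_fun y)%:E)).
  apply: eq_integral => y _; rewrite -!EFinM; congr EFin.
  rewrite mulrAC -expRD; congr (expR _ * _)%R.
  have -> : (a = p ^+ 2 * 2)%R by rewrite pE; field.
  by field; exact: lt0r_neq0.
rewrite ge0_integralZl//; last 3 first.
- by apply/measurable_EFinP; exact: measurable_gauss_fun.
- by move=> x _; rewrite lee_fin gauss_fun_ge0.
- by rewrite lee_fin divr_ge0 ?expR_ge0// ltW.
by rewrite integralT_gauss -EFinM; congr EFin; ring.
Qed.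

Definition gauss_kernel n (A : 'M[R]_n) (mu : 'cV[R]_n) (t : n.-tuple R) : R :=
  expR (- qform A (\col_i tnth t i - mu)%R / 2).

Lemma measurable_gauss_kernel n (A : 'M[R]_n) mu :
  measurable_fun [set: n.-tuple R] (gauss_kernel A mu).
Proof.
apply: measurableT_comp => //; apply: measurable_funM => //.
apply: measurableT_comp => //.
have mc i : measurable_fun [set: n.-tuple R]
    (fun t => (\col_i tnth t i - mu)%R i 0%R).
  under eq_fun do rewrite !mxE.
  by apply: measurable_funB => //; exact: measurable_tnth.
under eq_fun do rewrite qform_sum.
apply: measurable_sum => j; apply: measurable_funM => //.
by apply: measurable_sum => i; exact: measurable_funM.
Qed.

(** Integrating out the first coordinate preserves the Gaussian form, and the
centre of the new kernel is the old one without its first entry. *)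
Lemma integral_gauss_kernel_head n (A : 'M[R]_(1 + n)) (mu : 'cV[R]_(1 + n))
    (t : n.-tuple R) : positive_definite A ->
  \int[leb]_x (gauss_kernel A mu (tcons (x, t)))%:E =
  (Num.sqrt pi / Num.sqrt (A 0%R 0%R / 2) *
    gauss_kernel (schur A) (dsubmx mu) t)%:E.
Proof.
move=> pA; have [symA _] := pA.
rewrite /gauss_kernel qform_schur//.
rewrite -(integral_gauss_quadratic _ _ (mu 0 0)%R) ?positive_definite_diag//.
apply: eq_integral => x _; congr (expR (- _ / 2))%:E.
rewrite -qform_col_mx//; congr qform.
apply/colP => i; rewrite !mxE; case: splitP => j iE; rewrite !mxE.
  have -> : i = ord0 by apply: ord_inj; rewrite iE ord1.
  by rewrite ord1 tnth0.
have -> : i = lift ord0 j by apply: ord_inj; rewrite iE.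
by rewrite tnthS; congr (_ - mu _ _)%R; exact: val_inj.
Qed.

Definition qform2 (a b c x y : R) : R :=
  (a * x ^+ 2 + 2 * (x * (b * y)) + c * y ^+ 2)%R.

Lemma qform_M2 (A : 'M[R]_2) (v : 'cV[R]_2) : A^T = A ->
  qform A v = qform2 (A ord0 ord0) (A ord0 ord_max) (A ord_max ord_max)
    (v ord0 0%R) (v ord_max 0%R).
Proof.
move=> symA; have AE : A ord_max ord0 = A ord0 ord_max by rewrite -{1}symA mxE.
rewrite qform_sum !big_ord_recl !big_ord0 !addr0.
have -> : lift ord0 ord0 = ord_max :> 'I_2 by exact: val_inj.
by rewrite AE /qform2; ring.
Qed.

Lemma positive_definite_M2 (A : 'M[R]_2) : positive_definite A ->
  (A ord0 ord_max ^+ 2 < A ord0 ord0 * A ord_max ord_max)%R.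
Proof.
move=> pA; have a0 := positive_definite_diag ord0 pA.
have [symA posA] := pA.
pose v : 'cV[R]_2 :=
  (\col_i if i == ord0 then - A ord0 ord_max else A ord0 ord0)%R.
have v0 : v != 0%R.
  apply/eqP => /matrixP/(_ ord_max 0%R); rewrite !mxE/= => /eqP.
  by rewrite gt_eqF.
have := posA _ v0; rewrite -/(qform _ _) qform_M2// /v !mxE/= /qform2.
rewrite [X in (0 < X)%R -> _](_ : _ =
    A ord0 ord0 * (A ord0 ord0 * A ord_max ord_max - A ord0 ord_max ^+ 2))%R.
  by rewrite pmulr_rgt0// subr_gt0.
by ring.
Qed.

(** By induction on the dimension, integrating out the first coordinate until
the last two remain.  Only the existence of one pair [i], [j] is asserted:
exchangeability makes the choice immaterial. *)
Lemma gauss_kernel_pair_marginal n (A : 'M[R]_n.+2) (mu : 'cV[R]_n.+2) :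
    positive_definite A ->
  exists (i j : 'I_n.+2) (a b c m1 m2 K : R),
    [/\ i != j, (0 < a)%R, (b ^+ 2 < a * c)%R, (0 <= K)%R &
    forall phi : R * R -> \bar R,
      measurable_fun [set: R * R] phi -> (forall p, 0 <= phi p) ->
    \int[lebesgue_tuple R n.+2]_t
      (phi (tnth t i, tnth t j) * (gauss_kernel A mu t)%:E) =
    \int[leb]_v \int[leb]_u
      (phi (u, v) * (K * expR (- qform2 a b c (u - m1) (v - m2) / 2))%:E)].
Proof.
have mphi2 m (i j : 'I_m) (phi : R * R -> \bar R) :
    measurable_fun [set: R * R] phi ->
    measurable_fun [set: m.-tuple R] (fun t => phi (tnth t i, tnth t j)).
  move=> mphi; apply: (measurableT_comp mphi).
  by apply: measurable_fun_pair; exact: measurable_tnth.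
have mker m (B : 'M[R]_m) nu (i j : 'I_m) (phi : R * R -> \bar R) :
    measurable_fun [set: R * R] phi ->
    measurable_fun [set: m.-tuple R] (fun t =>
      phi (tnth t i, tnth t j) * (gauss_kernel B nu t)%:E).
  move=> mphi; apply: emeasurable_funM; first exact: mphi2.
  by apply/measurable_EFinP; exact: measurable_gauss_kernel.
have ker0 m (B : 'M[R]_m) nu (i j : 'I_m) (phi : R * R -> \bar R) t :
    (forall p, 0 <= phi p) ->
    0 <= phi (tnth t i, tnth t j) * (gauss_kernel B nu t)%:E.
  by move=> phi0; rewrite mule_ge0// lee_fin expR_ge0.
elim: n A mu => [|n IH] A mu pA.
  have [symA posA] := pA.
  exists ord0, ord_max, (A ord0 ord0), (A ord0 ord_max), (A ord_max ord_max).
  exists (mu ord0 0%R), (mu ord_max 0%R), 1%R; split;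
    [by []|exact: positive_definite_diag|exact: positive_definite_M2
    |exact: ler01|].
  - move=> phi mphi phi0.
    pose g2 (t : 2.-tuple R) :=
      phi (tnth t ord0, tnth t ord_max) * (gauss_kernel A mu t)%:E.
    pose g1 (t : 1.-tuple R) := \int[leb]_u g2 (tcons (u, t)).
    have mg2 : measurable_fun setT g2 by exact: mker.
    have g20 t : 0 <= g2 t by exact: ker0.
    have mg1 : measurable_fun setT g1 by exact: measurable_integral_head.
    have g10 t : 0 <= g1 t by exact: integral_ge0.
    rewrite (integral_lebesgue_tupleS mg2 g20) (integral_lebesgue_tupleS mg1 g10).
    rewrite integral_dirac//=; last exact: measurable_integral_head.
    rewrite diracE mem_set// mul1e.
    apply: eq_integral => v _; apply: eq_integral => u _.
    have maxE : ord_max = lift ord0 ord0 :> 'I_2 by exact: val_inj.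
    rewrite mul1r /g2 /gauss_kernel qform_M2// !mxE maxE.
    by rewrite tnth0 tnthS tnth0.
have [i [j [a [b [c [m1 [m2 [K [ij a0 bac K0 IHphi]]]]]]]]] :=
  IH _ (dsubmx (mu : 'cV[R]_(1 + n.+2))) (schur_positive_definite pA).
set C := (Num.sqrt pi / Num.sqrt ((A : 'M[R]_(1 + n.+2)) 0 0 / 2))%R.
have C0 : (0 <= C)%R by rewrite divr_ge0.
exists (lift ord0 i), (lift ord0 j), a, b, c, m1, m2, (C * K)%R.
split; [by rewrite (inj_eq lift_inj)|exact: a0|exact: bac|exact: mulr_ge0|].
move=> phi mphi phi0; rewrite integral_lebesgue_tupleS; last 2 first.
- exact: mker.
- by move=> t; exact: ker0.
pose phiC p := phi p * C%:E.
have mphiC : measurable_fun [set: R * R] phiC by exact: emeasurable_funM.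
have phiC0 p : 0 <= phiC p by rewrite mule_ge0.
transitivity (\int[lebesgue_tuple R n.+2]_t (phiC (tnth t i, tnth t j) *
    (gauss_kernel (schur (A : 'M[R]_(1 + n.+2)))
      (dsubmx (mu : 'cV[R]_(1 + n.+2))) t)%:E)).
  apply: eq_integral => t _; under eq_integral do rewrite !tnthS.
  rewrite /= ge0_integralZl//; last 2 first.
  - apply/measurable_EFinP.
    apply: (measurableT_comp (measurable_gauss_kernel A mu)).
    apply: (measurableT_comp (measurable_tcons (n:=n.+2))).
    by apply: measurable_fun_pair.
  - by move=> x _; rewrite lee_fin expR_ge0.
  by rewrite integral_gauss_kernel_head// EFinM muleA.
rewrite (IHphi _ mphiC phiC0); apply: eq_integral => v _.
apply: eq_integral => u _.
by rewrite /phiC -muleA -EFinM mulrA.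
Qed.

End marginals.

(** * Bivariate Gaussian densities *)

Section gaussian_pair.
Context d (T : measurableType d) (R : realType) (P : probability T R).
Notation leb := (@lebesgue_measure R).
Local Open Scope ereal_scope.

(** Common form of the two marginals below: once [x] is integrated out, the
square completed in [x] leaves the coefficient [c - b ^ 2 / a > 0] in front
of [(y - m) ^ 2]. *)
Lemma gaussian_law_of_kernel (V : T -> R) (a b c m m' K : R) :
    (0 < a)%R -> (b ^+ 2 < a * c)%R -> (0 <= K)%R ->
    (forall phi : R -> \bar R,
      measurable_fun [set: R] phi -> (forall x, 0 <= phi x) ->
      \int[P]_w phi (V w) = \int[leb]_y \int[leb]_x
        (phi y * (K * expR (- qform2 a b c (x - m') (y - m) / 2))%:E)) ->
  exists2 r, (0 < r)%R & gaussian_law P V m r.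
Proof.
move=> a0 bac K0 VE.
set q := ((c - b ^+ 2 / a) / 2)%R.
have q0 : (0 < q)%R by rewrite divr_gt0// subr_gt0 ltr_pdivrMr// mulrC.
have qE : (Num.sqrt q ^+ 2 = q)%R by rewrite sqr_sqrtr// ltW.
have p0 : (0 < Num.sqrt q)%R by rewrite sqrtr_gt0.
exists (Num.sqrt q)^-1%R; first by rewrite invr_gt0.
set C := (Num.sqrt pi / Num.sqrt (a / 2))%R.
apply: (@gaussian_law_of_density _ _ _ _ _ _ _ (K * C)%R) => //.
  by rewrite mulr_ge0// divr_ge0.
move=> phi mphi phi0; rewrite (VE _ mphi phi0); apply: eq_integral => y _.
transitivity (\int[leb]_x (phi y * K%:E * (expR (- (a * (x - m') ^+ 2 +
    2 * ((x - m') * (b * (y - m))) + c * (y - m) ^+ 2) / 2))%:E)).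
  by apply: eq_integral => x _; rewrite EFinM muleA.
rewrite ge0_integralZl//; last 2 first.
- apply/measurable_EFinP; apply: measurableT_comp => //.
  apply: measurable_funM => //; apply: measurableT_comp => //.
  apply: measurable_funD => //; apply: measurable_funD => //.
    apply: measurable_funM => //; apply: measurable_funX.
    exact: measurable_funB.
  apply: measurable_funM => //.
  by apply: measurable_funM => //; exact: measurable_funB.
- by rewrite mule_ge0// lee_fin.
rewrite integral_gauss_quadratic// -muleA -EFinM mulrA /gauss_fun.
congr (_ * (_ * expR _)%:E).
rewrite !exprMn qE /q.
by field; exact: lt0r_neq0.
Qed.

Variables (U V : T -> R) (a b c m1 m2 K : R).
Hypothesis a_gt0 : (0 < a)%R.
Hypothesis bac : (b ^+ 2 < a * c)%R.
Hypothesis K_ge0 : (0 <= K)%R.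
Hypothesis UVE : forall phi : R * R -> \bar R,
  measurable_fun [set: R * R] phi -> (forall p, 0 <= phi p) ->
  \int[P]_w phi (U w, V w) = \int[leb]_v \int[leb]_u
    (phi (u, v) * (K * expR (- qform2 a b c (u - m1) (v - m2) / 2))%:E).

Lemma gaussian_pair_snd : exists2 r, (0 < r)%R & gaussian_law P V m2 r.
Proof.
apply: (@gaussian_law_of_kernel V a b c m2 m1 K) => // phi mphi phi0.
apply: (UVE (phi := phi \o snd)) => [|p]; last exact: phi0.
by apply: (measurableT_comp mphi); exact: measurable_snd.
Qed.

(** In the coordinates [w = u - v] and [v] the form with coefficients
[(a, b, c)] has coefficient [a + 2 b + c] on [v ^ 2], [a + b] on the cross
term and [a] on [w ^ 2]; its determinant is still [a c - b ^ 2]. *)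
Lemma gaussian_pair_diff :
  exists2 r, (0 < r)%R & gaussian_law P (U \- V)%R (m1 - m2)%R r.
Proof.
have abc : (0 < a + b *+ 2 + c)%R.
  rewrite -(pmulr_rgt0 _ a_gt0).
  have -> : (a * (a + b *+ 2 + c) = (a + b) ^+ 2 + (a * c - b ^+ 2))%R by ring.
  by rewrite ltr_wpDl ?sqr_ge0// subr_gt0.
apply: (@gaussian_law_of_kernel _ (a + b *+ 2 + c)%R (a + b)%R a _ m2 K) => //.
  rewrite -subr_gt0.
  have -> : ((a + b *+ 2 + c) * a - (a + b) ^+ 2 = a * c - b ^+ 2)%R by ring.
  by rewrite subr_gt0.
move=> phi mphi phi0.
pose F (p : R * R) := phi p.2 *
  (K * expR (- qform2 (a + b *+ 2 + c) (a + b) a (p.1 - m2)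
    (p.2 - (m1 - m2)) / 2))%:E.
have F0 p : 0 <= F p by rewrite mule_ge0// lee_fin mulr_ge0// expR_ge0.
have mqf a' b' c' n1 n2 : measurable_fun [set: R * R]
    (fun p => (K * expR (- qform2 a' b' c' (p.1 - n1) (p.2 - n2) / 2))%R).
  apply: measurable_funM => //; apply: measurableT_comp => //.
  apply: measurable_funM => //; apply: measurableT_comp => //.
  have m1' : measurable_fun [set: R * R] (fun p => p.1 - n1)%R.
    exact: measurable_funB.
  have m2' : measurable_fun [set: R * R] (fun p => p.2 - n2)%R.
    exact: measurable_funB.
  apply: measurable_funD; [apply: measurable_funD|].
  - by apply: measurable_funM => //; exact: measurable_funX.
  - apply: measurable_funM => //; apply: measurable_funM => //.
    exact: measurable_funM.
  - by apply: measurable_funM => //; exact: measurable_funX.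
have mF : measurable_fun [set: R * R] F.
  apply: emeasurable_funM; first exact: measurableT_comp.
  by apply/measurable_EFinP; exact: mqf.
rewrite -[RHS](fubini_tonelli (m1 := leb) (m2 := leb) F mF F0).
have mB : measurable_fun [set: R * R] (fun p => phi (p.1 - p.2)%R).
  by apply: (measurableT_comp mphi); exact: measurable_funB.
rewrite (UVE mB (fun=> phi0 _)).
apply: eq_integral => v _; rewrite (@ge0_integral_affine _ 1%R v) ?ltr01//.
- apply: eq_integral => w _; rewrite mule1 /F/= mul1r addrAC subrr add0r.
  by congr (_ * (_ * expR (- _ / 2))%:E); rewrite /qform2; ring.
- apply: emeasurable_funM.
    exact: (measurableT_comp mB (pair2_measurable v)).
  apply/measurable_EFinP.
  exact: (measurableT_comp (mqf _ _ _ _ _) (pair2_measurable v)).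
- by move=> x; rewrite mule_ge0// lee_fin mulr_ge0// expR_ge0.
Qed.

End gaussian_pair.

(** * Exchangeability and the mean difference *)

Section exchangeable_pairs.
Context d (T : measurableType d) (R : realType) (P : probability T R).
Local Open Scope ereal_scope.

Lemma perm_pair (I : finType) (i j i' j' : I) : i != j -> i' != j' ->
  exists s : {perm I}, s i = i' /\ s j = j'.
Proof.
move=> ij ij'; exists (tperm i i' * tperm (tperm i i' j) j')%g.
rewrite !permM tpermL tpermL; split => //.
rewrite tpermD//; last by rewrite eq_sym.
by rewrite -{2}(tpermL i i') (inj_eq perm_inj) eq_sym.
Qed.

(** Apply exchangeability to a permutation sending [(i, j)] to [(i', j')]. *)
Lemma exchangeable_pair n (X : {RV P >-> n.-tuple R}) (i j i' j' : 'I_n)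
    (phi : R * R -> \bar R) : exchangeable X -> i != j -> i' != j' ->
    measurable_fun [set: R * R] phi -> (forall p, 0 <= phi p) ->
  \int[P]_w phi (component X i w, component X j w) =
  \int[P]_w phi (component X i' w, component X j' w).
Proof.
move=> exX ij ij' mphi phi0; have [s [si sj]] := perm_pair ij ij'.
pose psi (t : n.-tuple R) := phi (tnth t i, tnth t j).
have mpsi : measurable_fun [set: n.-tuple R] psi.
  apply: (measurableT_comp mphi).
  by apply: measurable_fun_pair; exact: measurable_tnth.
have psi0 t : 0 <= psi t by exact: phi0.
pose Y w := [tuple component X (s k) w | k < n].
have mY : measurable_fun [set: T] Y.
  apply/measurable_fun_tnthP => k.
  rewrite (_ : _ \o _ = component X (s k)); last first.
    by apply/funext => w /=; rewrite tnth_mktuple.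
  by apply: (measurableT_comp (measurable_tnth (s k))).
have mX : measurable_fun [set: T] X by [].
transitivity (\int[pushforward P Y]_t psi t).
  transitivity (\int[pushforward P X]_t psi t).
    by rewrite ge0_integral_pushforward.
  by apply: eq_measure_integral => A mA _; exact: exX.
rewrite ge0_integral_pushforward//; apply: eq_integral => w _.
by rewrite /psi/= !tnth_mktuple si sj.
Qed.
End exchangeable_pairs.

Section gini.
Context d (T : measurableType d) (R : realType) (P : probability T R).
Notation leb := (@lebesgue_measure R).

Local Open Scope ereal_scope.

Lemma exchangeable_gaussian_pair n (X : {RV P >-> n.+2.-tuple R}) mu Sigma :
    exchangeable X ->
    elliptically_contoured X mu Sigma (fun x => expR (- x / 2))%R ->
  exists (a b c m1 m2 K : R),
    [/\ (0 < a)%R, (b ^+ 2 < a * c)%R, (0 <= K)%R &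
    forall (i j : 'I_n.+2) (phi : R * R -> \bar R), i != j ->
      measurable_fun [set: R * R] phi -> (forall p, 0 <= phi p) ->
    \int[P]_w phi (component X i w, component X j w) =
    \int[leb]_v \int[leb]_u
      (phi (u, v) * (K * expR (- qform2 a b c (u - m1) (v - m2) / 2))%:E)].
Proof.
move=> exX [pS [k [mf f0 XE]]].
have [i0 [j0 [a [b [c [m1 [m2 [K [ij0 a0 bac K0 margE]]]]]]]]] :=
  gauss_kernel_pair_marginal mu (positive_definite_inv pS).
set k' := (k * (Num.sqrt (\det Sigma))^-1)%R.
have k'0 : (0 <= k')%R.
  (* The sign of [k'] is that of the density at any point. *)
  have := f0 [tuple of nseq n.+2 0%R].
  by rewrite /ec_density pmulr_lge0 ?expR_gt0.
exists a, b, c, m1, m2, (k' * K)%R.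
split; [exact: a0|exact: bac|exact: mulr_ge0|].
move=> i j phi ij mphi phi0; rewrite (exchangeable_pair exX ij ij0 mphi phi0).
pose psi (t : n.+2.-tuple R) := phi (tnth t i0, tnth t j0).
have mpsi : measurable_fun [set: n.+2.-tuple R] psi.
  apply: (measurableT_comp mphi).
  by apply: measurable_fun_pair; exact: measurable_tnth.
have psi0 t : 0 <= psi t by exact: phi0.
transitivity (\int[distribution P X]_t psi t).
  by rewrite (ge0_integral_distribution X mpsi psi0).
rewrite (ge0_integral_density mf f0 XE mpsi psi0).
pose phik p := phi p * k'%:E.
have mphik : measurable_fun [set: R * R] phik by exact: emeasurable_funM.
have phik0 p : 0 <= phik p by rewrite mule_ge0// lee_fin.
transitivity (\int[lebesgue_tuple R n.+2]_t (phik (tnth t i0, tnth t j0) *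
    (gauss_kernel (invmx Sigma) mu t)%:E)).
  by apply: eq_integral => t _; rewrite /phik -muleA -EFinM.
rewrite (margE _ mphik phik0).
apply: eq_integral => v _; apply: eq_integral => u _.
by rewrite /phik -muleA -EFinM mulrA.
Qed.

(** The parameters [m], [r] are common to all the coordinates, since every
coordinate is the second component of a pair with the same law. *)
Lemma exchangeable_gaussian_laws n (X : {RV P >-> n.+2.-tuple R}) mu Sigma :
    exchangeable X ->
    elliptically_contoured X mu Sigma (fun x => expR (- x / 2))%R ->
  exists (m r : R), [/\ (0 < r)%R,
    forall i, gaussian_law P (component X i) m r &
    forall i j, i != j -> exists m' r', (0 < r')%R /\
      gaussian_law P (component X i \- component X j)%R m' r'].
Proof.
move=> exX ecX.
have [a [b [c [m1 [m2 [K [a0 bac K0 XE]]]]]]] :=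
  exchangeable_gaussian_pair exX ecX.
have [r r0 Xr] := gaussian_pair_snd a0 bac K0
  (fun phi => @XE ord0 ord_max phi isT).
exists m2, r; split => // [i phi mphi phi0|i j ij].
  rewrite -(Xr _ mphi phi0).
  have [k ki] : exists k, k != i.
    exists (if i == ord0 then ord_max else ord0).
    by case: (eqVneq i ord0) => [->|]; rewrite // eq_sym.
  pose phi2 (p : R * R) := phi p.2.
  have mphi2 : measurable_fun [set: R * R] phi2.
    by apply: (measurableT_comp mphi); exact: measurable_snd.
  have phi20 p : 0 <= phi2 p by exact: phi0.
  exact: (@exchangeable_pair _ _ _ _ _ X k i ord0 ord_max phi2).
have [r' r'0 Wr'] := gaussian_pair_diff a0 bac K0
  (fun phi => @XE i j phi ij).
by exists (m1 - m2)%R, r'.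
Qed.

(** Equal means force [m' = 0], hence [|U - V|] has mean [r' / sqrt pi].  On the
other side [r' ^ 2 / 2] is the variance of [U - V], that is
[r ^ 2 * (1 - rho)], where [rho] is the correlation of [U] and [V]. *)
Lemma abs_difference_gaussian (U V : T -> R) m m' r r' :
    measurable_fun [set: T] U -> measurable_fun [set: T] V ->
    (0 < r)%R -> (0 < r')%R ->
    gaussian_law P U m r -> gaussian_law P V m r ->
    gaussian_law P (U \- V)%R m' r' ->
  'E_P[fun w => `|U w - V w|%R] =
    (2 / Num.sqrt pi * std_deviation P U *
      Num.sqrt (1 - correlation P U V))%:E.
Proof.
move=> mU mV r0 r'0 UN VN WN.
have r_ge0 := ltW r0; have r'_ge0 := ltW r'0.
have mW : measurable_fun [set: T] (U \- V)%R by exact: measurable_funB.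
have U2 := gaussian_Lfun2 mU UN.
have V2 := gaussian_Lfun2 mV VN.
have Pfin : P [set: T] \is a fin_num := fin_num_measure P _ measurableT.
have U1 := Lfun_subset12 Pfin U2; have V1 := Lfun_subset12 Pfin V2.
have UV1 := Lfun2_mul_Lfun1 U2 V2.
have m'0 : m' = 0%R.
  apply: EFin_inj; rewrite -(gaussian_expectation mW WN) expectationB//.
  by rewrite !(gaussian_expectation _ UN, gaussian_expectation _ VN)// subee.
have VU := gaussian_variance mU UN.
have VV := gaussian_variance mV VN.
have cfin : covariance P U V \is a fin_num by exact: covariance_fin_num.
have r'E : (r' ^+ 2 / 2 = r ^+ 2 - 2 * fine (covariance P U V))%R.
  apply: EFin_inj; rewrite -(gaussian_variance mW WN) varianceB// VU VV.
  by rewrite -[in LHS](fineK cfin) -EFinM -!EFinD; congr EFin; field.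
have -> : 'E_P[fun w => `|U w - V w|%R] = (r' / Num.sqrt pi)%:E.
  rewrite -(gaussian_abs_moment r'_ge0 WN) unlock.
  by apply: eq_integral => w _; rewrite m'0 subr0.
have sqrt_pi_gt0 : (0 < Num.sqrt pi :> R)%R by rewrite sqrtr_gt0 pi_gt0.
rewrite /correlation /std_deviation VU VV/= -expr2.
rewrite sqr_sqrtr ?divr_ge0 ?sqr_ge0//.
rewrite -mulrA -sqrtrM ?divr_ge0 ?sqr_ge0//.
have -> : (r ^+ 2 / 2 * (1 - fine (covariance P U V) / (r ^+ 2 / 2)) =
    (r' / 2) ^+ 2)%R.
  have -> : ((r' / 2) ^+ 2 = r' ^+ 2 / 2 / 2)%R by field.
  by rewrite r'E; field; exact: lt0r_neq0.
rewrite sqrtr_sqr ger0_norm ?divr_ge0//; congr EFin; field.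
exact: lt0r_neq0.
Qed.

End gini.

Theorem proposition4 (d : measure_display) (T : measurableType d)
    (R : realType) (P : probability T R) (n : nat) (n_ge2 : (2 <= n)%N)
    (X : {RV P >-> n.-tuple R}) (mu : 'cV[R]_n) (Sigma : 'M[R]_n)
    (exchX : exchangeable X)
    (ecX : elliptically_contoured X mu Sigma (fun x => expR (- x / 2))) :
  let X1 := component X (Ordinal (ltnW n_ge2)) in
  let sigma1 := std_deviation P X1 in
  let rho i j := correlation P (component X i) (component X j) in
  [/\ ((sigma1 ^+ 2)%:E = 'V_P[X1])%E, 0 < sigma1 &
      GMD X = (2 / Num.sqrt pi * sigma1 * ('C(n, 2))%:R^-1 *
        \sum_(i < n) \sum_(j < n | (i < j)%N) Num.sqrt (1 - rho i j))%:E].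
Proof.
case: n n_ge2 X mu Sigma exchX ecX => [//|[//|n]] n_ge2 X mu Sigma exchX ecX.
move=> X1 sigma1 rho.
have [m [r [r0 XN XB]]] := exchangeable_gaussian_laws exchX ecX.
have mX i : measurable_fun [set: T] (component X i).
  by apply: (measurableT_comp (measurable_tnth i)).
have varX i : ('V_P[component X i] = (r ^+ 2 / 2)%:E)%E.
  exact: gaussian_variance (mX i) (XN i).
have sdX i : std_deviation P (component X i) = sigma1.
  by rewrite /sigma1 /std_deviation !varX.
have s2 : sigma1 ^+ 2 = r ^+ 2 / 2.
  by rewrite /sigma1 /std_deviation varX/= sqr_sqrtr// divr_ge0 ?sqr_ge0.
split.
- by rewrite s2 varX.
- by rewrite /sigma1 /std_deviation varX sqrtr_gt0/= divr_gt0// exprn_gt0.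
rewrite /GMD -mulrA mulrCA EFinM; congr (_ * _)%E.
rewrite mulr_sumr -sumEFin; apply: eq_bigr => i _.
rewrite mulr_sumr -sumEFin; apply: eq_bigr => j ij.
have ij' : i != j by apply: contraTneq ij => ->; rewrite ltnn.
have [m' [r' [r'0 WN]]] := XB _ _ ij'.
by rewrite (abs_difference_gaussian (mX i) (mX j) r0 r'0 (XN i) (XN j) WN) sdX.
Qed.
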